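(* Let $(W,S)$ be a Coxeter system with $S$ finite, let $J\subseteq S$, let $w\in{}^JW$, and let $s\in A_R^J(w)$. Then: (1) $A_R^J(ws)=\bigl(A_R^J(w)\setminus\{s\}\bigr)\sqcup\bigl(\Delta_R^J(w,s)\setminus A_R^J(w)\bigr)$, where $\sqcup$ denotes disjoint union. (2) $A_R^J(w)\setminus A_R^J(ws)=\{s\}$. (3) $\Bigl||A_R^J(w)|-|A_R^J(ws)|\Bigr|\le\max\{1,\deg(s)-1\}$.
   Context: Let $(W,S)$ be a Coxeter system with length function $\ell$, and let $T=\{wsw^{-1}\mid w\in W,\ s\in S\}$ be its set of reflections. For $J\subseteq S$, ${}^JW=\{w\in W\mid \ell(rw)>\ell(w)\ \text{for all } r\in J\}$, the set of minimal length representatives of the cosets $W_Jw$, where $W_J=\langle J\rangle$. The right ascent set of $w$ is $A_R(w)=\{s\in S\mid \ell(ws)=\ell(w)+1\}$, and the right $J$-ascent set is $A_R^J(w)=\{s\in A_R(w)\mid ws\in{}^JW\}$. The right inversion set is $N_R(w)=\{t\in T\mid \ell(wt)<\ell(w)\}$. For $w\in W$ and $s\in S$, $\Delta_R^J(w,s):=\{r\in S\mid wsr\in{}^JW,\ \ell(srs)=3,\ srs\notin N_R(w)\}$. Here the condition $\ell(srs)=3$ is equivalent to $rs\neq sr$. For $s\in S$, $\operatorname{Adj}(s)=\{r\in S\mid rs\ne sr,\ r\neq s\}$ and $\deg(s)=|\operatorname{Adj}(s)|$. *)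

(* Defs.v *)
From HB Require Import structures.
From mathcomp Require Import all_boot all_order all_algebra finmap.
From mathcomp Require Import boolp classical_sets functions cardinality.

Set Implicit Arguments.
Unset Strict Implicit.
Unset Printing Implicit Defensive.

Local Open Scope classical_set_scope.
Local Open Scope group_scope.

Section CoxeterDefs.
Variable W : groupType.
Implicit Types (S J : set W) (w s t : W) (u v : seq W).

Definition word_in S : set (seq W) := [set u | forall x, x \in u -> S x].

Definition word_prod u : W := \big[*%g/1]_(x <- u) x.

(* The value 0 encodes infinity. *)
Definition coxeter_matrix S (m : W -> W -> nat) : Prop :=
  forall s t, S s -> S t -> m s t = m t s /\ (m s t = 1%N <-> s = t).

Definition dihedral_relator s t (k : nat) : seq W := flatten (nseq k [:: s; t]).

(* The congruence on words over S generated by the relations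
   (s t)^(m s t) = 1. When m s t = 0 (infinity) the relator is the empty word,
   so it imposes nothing. Since m s s = 1 makes every generator an involution,
   the monoid presented by these relations is the group they present, and
   formal inverses are not needed. *)
Inductive coxeter_equiv S (m : W -> W -> nat) : seq W -> seq W -> Prop :=
| CoxeterRelator u v s t : S s -> S t ->
    coxeter_equiv S m (u ++ dihedral_relator s t (m s t) ++ v) (u ++ v)
| CoxeterRefl u : coxeter_equiv S m u u
| CoxeterSym u v : coxeter_equiv S m u v -> coxeter_equiv S m v u
| CoxeterTrans u v x : coxeter_equiv S m u v -> coxeter_equiv S m v x ->
    coxeter_equiv S m u x.

(* W = < S | (s t)^(m s t) = 1 > for some Coxeter matrix m. *)
Definition coxeter_system S : Prop :=
  exists m : W -> W -> nat,
    [/\ coxeter_matrix S m,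
        forall w, exists2 u, word_in S u & word_prod u = w
      & forall u v, word_in S u -> word_in S v ->
          (word_prod u = word_prod v <-> coxeter_equiv S m u v)].

Definition word_sizes S w : set nat :=
  [set n | exists u, [/\ word_in S u, word_prod u = w & size u = n]].

(* The minimum of [word_sizes S w]; the default value 0 is only used when this
   set is empty, which never happens if S generates W as a monoid. *)
Definition cox_length S w : nat :=
  xget 0%N [set n | word_sizes S w n /\ forall k, word_sizes S w k -> (n <= k)%N].

Definition reflections S : set W :=
  [set t | exists w s, S s /\ t = w * s * w^-1].

Definition min_reps S J : set W :=
  [set w | forall r, J r -> (cox_length S (r * w) > cox_length S w)%N].

Definition right_ascents S w : set W :=
  [set s | S s /\ cox_length S (w * s) = (cox_length S w + 1)%N].

Definition right_ascentsJ S J w : set W :=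
  [set s | right_ascents S w s /\ min_reps S J (w * s)].

Definition right_inversions S w : set W :=
  [set t | reflections S t /\ (cox_length S (w * t) < cox_length S w)%N].

Definition DeltaR S J w s : set W :=
  [set r | [/\ S r, min_reps S J (w * s * r), cox_length S (s * r * s) = 3%N
             & ~ right_inversions S w (s * r * s)]].

Definition Adj S s : set W := [set r | [/\ S r, r * s <> s * r & r <> s]].

End CoxeterDefs.

(* Cardinality of a finite set (junk value 0 on infinite ones). *)
Definition set_card (T : choiceType) (A : set T) : nat := #|` fset_set A |.

Definition cox_deg (W : groupType) (S : set W) (s : W) : nat := set_card (Adj S s).

(* Main.v *)
Require Import Defs.
From HB Require Import structures.
From mathcomp Require Import all_boot all_order all_algebra finmap.
From mathcomp Require Import boolp classical_sets functions cardinality.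
From mathcomp Require Import zify.

(** Everything rests on the exchange property, which is derived from the
    presentation. To a word x_1 ... x_n one attaches the list of the elements
    t_i = (x_(i+1) ... x_n)^-1 * x_i * (x_(i+1) ... x_n); multiplying the
    product by t_i deletes the letter x_i. In a relator (s r)^m the reflections
    of the first half reappear in the second, so inserting or removing it
    preserves the parity of the multiplicity of each reflection
    ([odd_count_refl_seq]). Hence if s does not increase the length of w, then
    s occurs in the list of every word of w, and w * s is obtained from that
    word by deleting a letter ([exchange]).

    Let now w and s be as in the theorem, and let r be a generator.
    - If r <> s is a J-ascent of w, then w has no descent among s and r, so it
      is shortest in its coset of the subgroup they generate
      ([ascents_coset_min]), and w * s * r gains two letters. It is still a
      minimal representative by Deodhar's dichotomy ([min_reps_mul_gen]): the
      alternative j * w * s = w * s * r with j in J makes s and r commute and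
      then contradicts the minimality of w * r.
    - If r is a J-ascent of w * s but not of w, then r and s do not commute,
      since otherwise w * r would be a prefix of w * s * r = w * r * s; and
      s * r * s is no inversion of w, since w * s * r has two letters more
      than w. So r is in Delta.
    - If r is in Delta and were a descent of w * s, exchange would delete a
      letter of w, making s * r * s an inversion of w.

    These give the first claim, and the second follows since s is a descent of
    w * s. For the third, passing from w to w * s loses the one element s
    and gains a subset of Adj(s), so the number of ascents changes by some k - 1
    with 0 <= k <= deg(s). *)

Set Implicit Arguments.
Unset Strict Implicit.
Unset Printing Implicit Defensive.

Local Open Scope classical_set_scope.
Local Open Scope ring_scope.

(** * Words and their sequences of reflections *)

Section Words.
Local Open Scope group_scope.
Variable W : groupType.
Implicit Types (I : set W) (s r t x : W) (u v : seq W).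

Lemma word_prod_nil : word_prod [::] = 1 :> W.
Proof. by rewrite /word_prod big_nil. Qed.

Lemma word_prod_cons x u : word_prod (x :: u) = x * word_prod u.
Proof. by rewrite /word_prod big_cons. Qed.

Lemma word_prod_cat u v : word_prod (u ++ v) = word_prod u * word_prod v.
Proof. by rewrite /word_prod big_cat. Qed.

Lemma word_in_cons I x u : I x -> word_in I u -> word_in I (x :: u).
Proof. by move=> Ix Iu y; rewrite inE => /orP[/eqP->|/Iu]. Qed.

Lemma word_in_cat I u v : word_in I u -> word_in I v -> word_in I (u ++ v).
Proof. by move=> Iu Iv y; rewrite mem_cat => /orP[/Iu|/Iv]. Qed.

Lemma word_in_consP I x u : word_in I (x :: u) -> I x /\ word_in I u.
Proof.
by move=> Iu; split=> [|y yu]; apply: Iu; rewrite inE ?eqxx ?yu ?orbT.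
Qed.

Lemma word_in_catP I u v :
  word_in I (u ++ v) -> word_in I u /\ word_in I v.
Proof.
by move=> Iuv; split=> y yu; apply: Iuv; rewrite mem_cat yu ?orbT.
Qed.

(** For a word x_1 ... x_n in involutions, the elements t_i such that
    multiplying x_1 ... x_n by t_i on the right deletes the letter x_i. *)
Fixpoint refl_seq u : seq W :=
  if u is x :: u' then x ^ word_prod u' :: refl_seq u' else [::].

Lemma refl_seq_cat u v :
  refl_seq (u ++ v) = map (conjg^~ (word_prod v)) (refl_seq u) ++ refl_seq v.
Proof.
by elim: u => //= x u ->; rewrite word_prod_cat conjgM.
Qed.

Lemma refl_seq_delete I u t :
    (forall x, I x -> x * x = 1) -> word_in I u -> t \in refl_seq u ->
  exists u', [/\ word_in I u', word_prod u' = word_prod u * t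
               & (size u').+1 = size u].
Proof.
move=> I2; elim: u => //= x u IHu /word_in_consP[Ix Iu].
rewrite inE => /orP[/eqP->|/IHu[//|u' [Iu' pu' su']]].
  exists u; split=> //.
  by rewrite word_prod_cons conjgE -mulgA mulVKg mulgA I2 ?mul1g.
exists (x :: u'); split; first exact: word_in_cons.
  by rewrite !word_prod_cons pu' mulgA.
by rewrite /= su'.
Qed.

Lemma word_prod_dihedral s r k :
  word_prod (dihedral_relator s r k) = (s * r) ^+ k.
Proof.
rewrite /dihedral_relator; elim: k => [|k IHk]; first by rewrite word_prod_nil.
by rewrite /= !word_prod_cons IHk expgS mulgA.
Qed.

(** Conjugating s or r by a power of the rotation s * r gives r times another
    power, because r inverts s * r. *)
Lemma refl_seq_dihedral s r k : s * s = 1 -> r * r = 1 ->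
  refl_seq (dihedral_relator s r k) =
  rev (mkseq (fun j => r * (s * r) ^+ j) k.*2).
Proof.
move=> s2 r2.
have sV : s^-1 = s by exact: mulg1_eq.
have rV : r^-1 = r by exact: mulg1_eq.
have flip j : (s * r) ^- j * r = r * (s * r) ^+ j.
  rewrite (conjgC ((s * r) ^- j)) conjVg conjXg.
  have -> : (s * r) ^ r = (s * r)^-1.
    by rewrite conjgE -(mulgA s) r2 mulg1 invgM sV rV.
  by rewrite expVgn invgK.
elim: k => // k IHk.
rewrite doubleS !mkseqS !rev_rcons -IHk.
rewrite /dihedral_relator /= -/(dihedral_relator s r k).
rewrite word_prod_cons word_prod_dihedral; congr [:: _, _ & _].
  rewrite conjgM !conjgE rV !mulgA flip -!mulgA; congr (_ * _).
  by rewrite (mulgA s) -expgS -expgnDr addnS addnn.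
by rewrite conjgE mulgA flip -mulgA -expgnDr addnn.
Qed.

(** When (s * r) ^+ k = 1 the powers of s * r have period k, so each of the
    reflections r * (s * r) ^+ j with j < 2 * k is listed twice. *)
Lemma odd_count_refl_seq_dihedral (a : pred W) s r k :
    s * s = 1 -> r * r = 1 -> (s * r) ^+ k = 1 ->
  odd (count a (refl_seq (dihedral_relator s r k))) = false.
Proof.
move=> s2 r2 srk; rewrite refl_seq_dihedral // count_rev /mkseq -addnn iotaD.
rewrite add0n -{2}(addn0 k) iotaDl map_cat count_cat -map_comp.
set c := count _ _; set d := count _ _.
suff -> : d = c by rewrite addnn odd_double.
rewrite /d /c; congr (count _ _); apply: eq_map => j /=.
by rewrite expgnDr srk mul1g.
Qed.

End Words.

(** * The exchange property *)

Section Exchange.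
Local Open Scope group_scope.
Variables (W : groupType) (S : set W).
Hypothesis hWS : coxeter_system S.
Implicit Types (I J : set W) (w r s t x : W) (u v : seq W).

Local Notation len := (cox_length S).

Lemma gen_mulgg s : S s -> s * s = 1.
Proof.
case: hWS => m [mS _ mW] Ss; have [_ [_ /(_ erefl) mss]] := mS _ _ Ss Ss.
suff: word_prod [:: s; s] = word_prod [::] :> W.
  by rewrite !word_prod_cons word_prod_nil mulg1.
apply: (mW _ _ _ _).2 => //.
  by apply: word_in_cons => //; apply: word_in_cons.
by have := CoxeterRelator m [::] [::] Ss Ss; rewrite mss.
Qed.

(** The defining relations change the multiplicity of a reflection in
    [refl_seq] by an even number: this parity is an invariant of the group
    element and not only of the word. *)
Lemma odd_count_refl_seq (a : pred W) u v :
    word_in S u -> word_in S v -> word_prod u = word_prod v ->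
  odd (count a (refl_seq u)) = odd (count a (refl_seq v)).
Proof.
case: hWS => m [mS _ mW] Su Sv /(mW _ _ Su Sv).
elim=> {u v Su Sv} // [u v s t Ss St|u v x _ -> _ -> //].
have srm : (s * t) ^+ m s t = 1.
  rewrite -word_prod_dihedral -word_prod_nil; apply: (mW _ _ _ _).2 => //.
    rewrite /dihedral_relator; elim: (m s t) => //= k IHk.
    by apply: word_in_cons => //; apply: word_in_cons.
  by have := CoxeterRelator m [::] [::] Ss St; rewrite cats0.
rewrite !refl_seq_cat !count_cat !oddD !count_map.
rewrite odd_count_refl_seq_dihedral ?gen_mulgg //=.
by rewrite word_prod_cat word_prod_dihedral srm mul1g.
Qed.

Lemma cox_length_spec w :
  word_sizes S w (len w) /\ forall k, word_sizes S w k -> (len w <= k)%N.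
Proof.
suff: exists n, word_sizes S w n /\ forall k, word_sizes S w k -> (n <= k)%N.
  exact: (@xgetPex _ 0%N [set n | _]).
have [m [_ gen _]] := hWS; have [u0 Su0 pu0] := gen w.
have ex : exists n, `[< word_sizes S w n >].
  by exists (size u0); apply/asboolP; exists u0.
case: (ex_minnP ex) => n /asboolP nw nmin; exists n; split=> // k kw.
exact/nmin/asboolP.
Qed.

Lemma reduced_word w :
  exists u, [/\ word_in S u, word_prod u = w & size u = len w].
Proof. by have [] := cox_length_spec w. Qed.

Lemma cox_length_le u : word_in S u -> (len (word_prod u) <= size u)%N.
Proof. by move=> Su; apply: (cox_length_spec _).2; exists u. Qed.

Lemma cox_length_mul_word w u : word_in S u ->
  (len (w * word_prod u) <= len w + size u)%N.
Proof.
move=> Su; have [v [Sv <- <-]] := reduced_word w.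
by rewrite -word_prod_cat -size_cat; exact: cox_length_le (word_in_cat _ _).
Qed.

Lemma cox_length_gen_mul s w : S s -> (len (s * w) <= (len w).+1)%N.
Proof.
move=> Ss; have [v [Sv <- <-]] := reduced_word w.
by rewrite -word_prod_cons; exact: cox_length_le (word_in_cons _ _).
Qed.

Lemma cox_length_refl_lt u t :
    word_in S u -> size u = len (word_prod u) -> t \in refl_seq u ->
  (len (word_prod u * t) < len (word_prod u))%N.
Proof.
move=> Su redu /(refl_seq_delete gen_mulgg Su)[u' [Su' <- su']].
by rewrite -redu -su' ltnS cox_length_le.
Qed.

(** Appending s to a reduced word of w * s adds s once to the reflections of
    that word, where it was absent because w is not shorter than w * s. The
    multiplicity 1 being odd, s is among the reflections of every word of w. *)
Lemma exchange u s : word_in S u -> S s ->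
  (len (word_prod u * s) <= len (word_prod u))%N -> s \in refl_seq u.
Proof.
move=> Su Ss le_us; have [v [Sv pv sv]] := reduced_word (word_prod u * s).
have pvs : word_prod u = word_prod (v ++ [:: s]).
  rewrite word_prod_cat pv word_prod_cons word_prod_nil mulg1.
  by rewrite -mulgA gen_mulgg ?mulg1.
have sNv : s \notin refl_seq v.
  apply/negP => /(cox_length_refl_lt Sv); rewrite pv => /(_ sv).
  by rewrite -mulgA gen_mulgg // mulg1 ltnNge le_us.
have odd_s : odd (count_mem s (refl_seq u)).
  rewrite (odd_count_refl_seq _ Su _ pvs); last first.
    by apply: word_in_cat => //; apply: word_in_cons.
  rewrite refl_seq_cat count_cat count_map /= word_prod_cons word_prod_nil mulg1.
  rewrite conjg1 eqxx (eq_count (a2 := pred1 s)) ?(count_memPn sNv) // => x /=.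
  have {2}<- : s ^ s = s by rewrite conjgE mulKg.
  by rewrite (inj_eq (@conjg_inj _ s)).
by move: odd_s; apply: contraTT => /count_memPn ->.
Qed.

Lemma cox_length_mul_gen w s : S s ->
  len (w * s) = (len w).+1 \/ len w = (len (w * s)).+1.
Proof.
move=> Ss; have [u [Su <- redu]] := reduced_word w.
have up x : (len (x * s) <= (len x).+1)%N.
  have /(cox_length_mul_word x) : word_in S [:: s] by exact: word_in_cons.
  by rewrite word_prod_cons word_prod_nil mulg1 addn1.
have [le_us|] := leqP (len (word_prod u * s)) (len (word_prod u)).
  right; have := cox_length_refl_lt Su redu (exchange Su Ss le_us).
  have := up (word_prod u * s).
  rewrite -mulgA gen_mulgg // mulg1 => ? ?.
  by apply/eqP; rewrite eqn_leq; apply/andP.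
by left; apply/eqP; rewrite eqn_leq up.
Qed.

Lemma cox_length1 : len 1 = 0%N.
Proof.
by apply/eqP; rewrite -leqn0 -word_prod_nil; apply: (@cox_length_le [::]).
Qed.

Lemma cox_length_gen s : S s -> len s = 1%N.
Proof.
by move=> /(cox_length_mul_gen 1)[]; rewrite mul1g cox_length1.
Qed.

(** If s and r do not commute then s * r has length 2, and if s * r * s were
    shorter the exchange property would delete a letter of the word s r: then
    s * r * s would be r or s, and s and r would commute. *)
Lemma cox_length_srs s r : S s -> S r ->
  len (s * r * s) = 3%N <-> s * r <> r * s.
Proof.
move=> Ss Sr; split=> [len3 sr_rs|sr_rs].
  by move: len3; rewrite sr_rs -mulgA gen_mulgg // mulg1 cox_length_gen.
have Ssr : word_in S [:: s; r].
  by apply: word_in_cons => //; apply: word_in_cons.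
have psr : word_prod [:: s; r] = s * r.
  by rewrite !word_prod_cons word_prod_nil mulg1.
have len_sr : len (s * r) = 2%N.
  have := cox_length_mul_gen s Sr.
  rewrite (cox_length_gen Ss) => -[//|[sr0]].
  have [v [_ psr' sv]] := reduced_word (s * r).
  move: sv psr'; rewrite -sr0 => /size0nil ->; rewrite word_prod_nil => sr1.
  by case: sr_rs; rewrite -(mulg1_eq (esym sr1)) mulgV mulVg.
have [->|lt] := cox_length_mul_gen (s * r) Ss; first by rewrite len_sr.
have : s \in refl_seq [:: s; r].
  by apply: exchange => //; rewrite psr lt.
rewrite /= word_prod_cons word_prod_nil mulg1 conjg1 !inE => /orP[]/eqP s_r.
  by case: sr_rs; rewrite {2}s_r conjgE mulVKg.
by case: sr_rs; rewrite s_r.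
Qed.

(** * Elements without descents in a set of generators *)

(** An element w = g * z with no descent in I is shortest in its coset of the
    subgroup generated by I. If the word z ends with a letter a, then w * a is
    longer than w, so the exchange property applied to the word of w * a
    deletes a letter of z, or it deletes one of g and trades the final a of z
    for it. Either way z becomes shorter and g does not become longer. *)
Lemma ascents_coset_min I w (g : W) z :
    I `<=` S -> (forall a, I a -> (len w < len (w * a))%N) ->
    word_in I z -> w = g * word_prod z ->
  (len w <= len g)%N.
Proof.
move=> IS asc; have [n] := ubnP (size z).
have I2 a : I a -> a * a = 1 by move=> /IS /gen_mulgg.
elim: n => // n IHn in g z *; case/lastP: z => [|z a].
  by rewrite word_prod_nil mulg1 => _ _ ->.
rewrite size_rcons ltnS -cats1 => lt_z /word_in_catP[Iz] /word_in_consP[Ia _].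
rewrite word_prod_cat word_prod_cons word_prod_nil mulg1 mulgA => w_gza.
have wa : w * a = g * word_prod z by rewrite {1}w_gza -(mulgA _ a a) I2 ?mulg1.
have [p [Sp pg redg]] := reduced_word g.
have Spz : word_in S (p ++ z) by apply: word_in_cat => // x /Iz /IS.
have : a \in refl_seq (p ++ z).
  apply: exchange; [by []|exact: IS|].
  by rewrite word_prod_cat pg -wa -mulgA I2 // mulg1 ltnW ?asc.
rewrite refl_seq_cat mem_cat => /orP[/mapP[t tp a_t]|].
  have lt_gt : (len (g * t) < len g)%N.
    by rewrite -pg; apply: cox_length_refl_lt; rewrite ?pg.
  apply: leq_trans (ltnW lt_gt); apply: IHn lt_z Iz _.
  by rewrite w_gza a_t -!mulgA conjgE !mulVKg.
move=> /(refl_seq_delete I2 Iz)[z' [Iz' pz' sz']].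
by apply: (IHn g z'); rewrite ?pz' ?mulgA // -ltnS sz' ltnW.
Qed.

Section TwoAscents.
Variables (w s r : W).
Hypotheses (Ss : S s) (Sr : S r) (s_neq_r : s <> r).
Hypotheses (ws : (len w < len (w * s))%N) (wr : (len w < len (w * r))%N).

Let coset_min (g : W) z : word_in [set s; r] z -> w = g * word_prod z ->
  (len w <= len g)%N.
Proof.
apply: ascents_coset_min => [a|a]; first by case=> ->.
by case=> ->.
Qed.

(** If r were a descent of w * s, exchange in a reduced word of w followed by s
    would give an inversion t = s * r * s of w, and w * t would be an element
    shorter than w in its coset of the subgroup generated by s and r. *)
Lemma two_ascents_sr : len (w * s * r) = (len w).+2.
Proof.
have lws : len (w * s) = (len w).+1.
  have [//|eq_w] := cox_length_mul_gen w Ss.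
  by move: ws; rewrite eq_w ltnNge leqnSn.
have [->|lt] := cox_length_mul_gen (w * s) Sr; first by rewrite lws.
have [p [Sp pw redw]] := reduced_word w.
have pws : word_prod (p ++ [:: s]) = w * s.
  by rewrite word_prod_cat pw word_prod_cons word_prod_nil mulg1.
have : r \in refl_seq (p ++ [:: s]).
  apply: exchange => //; last by rewrite pws lt.
  by apply: word_in_cat => //; apply: word_in_cons.
rewrite refl_seq_cat mem_cat /= word_prod_cons word_prod_nil mulg1 conjg1 inE.
move=> /orP[/mapP[t tp r_t]|/eqP/esym//].
have lt_wt : (len (w * t) < len w)%N.
  by rewrite -pw; apply: cox_length_refl_lt; rewrite ?pw.
suff : (len w <= len (w * t))%N by rewrite leqNgt lt_wt.
apply: (coset_min (z := [:: s; r; s])).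
  apply: word_in_cons; first by left.
  by apply: word_in_cons; [right|apply: word_in_cons => //; left].
have t2 : t * t = 1.
  by apply: (@conjg_inj _ s); rewrite conjMg -r_t gen_mulgg // conj1g.
have -> : word_prod [:: s; r; s] = t.
  rewrite !word_prod_cons word_prod_nil mulg1 r_t conjgE -!mulgA mulVKg.
  by rewrite gen_mulgg // mulg1.
by rewrite -mulgA t2 mulg1.
Qed.

(** Exchange in the word of w * s * r cannot delete a letter of w, because w is
    shortest in its coset of the subgroup generated by s and r; nor can it
    delete the final s or r, because s and r do not commute. *)
Lemma two_ascents_srs : s * r <> r * s -> len (w * s * r * s) = (len w).+3.
Proof.
move=> sr_rs; have [->|lt] := cox_length_mul_gen (w * s * r) Ss.
  by rewrite two_ascents_sr.
have [p [Sp pw redw]] := reduced_word w.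
have psr : word_prod [:: s; r] = s * r.
  by rewrite !word_prod_cons word_prod_nil mulg1.
have pwsr : word_prod (p ++ [:: s; r]) = w * s * r.
  by rewrite word_prod_cat pw psr mulgA.
have : s \in refl_seq (p ++ [:: s; r]).
  apply: exchange => //; last by rewrite pwsr lt.
  by apply: word_in_cat => //; apply: word_in_cons => //; apply: word_in_cons.
rewrite refl_seq_cat mem_cat psr /= word_prod_cons word_prod_nil mulg1 conjg1.
rewrite !inE => /orP[/mapP[t tp s_t]|/orP[]/eqP s_r]; last 2 first.
- by case: sr_rs; rewrite {2}s_r conjgE mulVKg.
- by case: s_neq_r.
have lt_wt : (len (w * t) < len w)%N.
  by rewrite -pw; apply: cox_length_refl_lt; rewrite ?pw.
suff : (len w <= len (w * t))%N by rewrite leqNgt lt_wt.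
(* t = s * r * s * r * s, since t ^ (s * r) = s *)
apply: (coset_min (z := [:: s; r; s; r; s])).
  have [Is Ir] : [set s; r] s /\ [set s; r] r by split; [left|right].
  by do 5!(apply: word_in_cons => //).
have t2 : t * t = 1.
  by apply: (@conjg_inj _ (s * r)); rewrite conjMg -s_t gen_mulgg // conj1g.
have -> : word_prod [:: s; r; s; r; s] = t.
  have -> : t = s ^ (s * r)^-1 by rewrite {1}s_t conjgK.
  have [sV rV] : s^-1 = s /\ r^-1 = r.
    by split; apply: mulg1_eq; rewrite gen_mulgg.
  by rewrite !word_prod_cons word_prod_nil mulg1 conjgE invgK invgM sV rV !mulgA.
by rewrite -mulgA t2 mulg1.
Qed.

End TwoAscents.

(** * Minimal coset representatives *)

Section MinReps.
Variable J : set W.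
Hypothesis hJ : J `<=` S.

Lemma min_reps_prefix w s : S s ->
  (len w < len (w * s))%N -> min_reps S J (w * s) -> min_reps S J w.
Proof.
move=> Ss w_ws min_ws j Jj; have := min_ws j Jj.
have := cox_length_mul_gen (j * w) Ss.
have -> : j * w * s = j * (w * s) by rewrite mulgA.
by lia.
Qed.

(** Deodhar's dichotomy. If j is a left descent of w * s, apply the exchange
    property to j followed by a reduced word of w: the deleted letter must be j,
    as s is an ascent of w. *)
Lemma min_reps_mul_gen w s : S s ->
    (len w < len (w * s))%N -> min_reps S J w ->
  min_reps S J (w * s) \/ exists2 j, J j & j * w = w * s.
Proof.
move=> Ss w_ws min_w.
have [[j Jj jw]|noj] := pselect (exists2 j, J j & j * w = w * s).
  by right; exists j.
left=> j Jj; rewrite ltnNge; apply/negP => desc; apply: noj; exists j => //.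
have [p [Sp pw redw]] := reduced_word w.
have pjw : word_prod (j :: p) = j * w by rewrite word_prod_cons pw.
have : s \in refl_seq (j :: p).
  apply: exchange => //; first by apply: word_in_cons => //; apply: hJ.
  rewrite pjw -mulgA; apply: leq_trans desc _.
  have := min_w j Jj; have := cox_length_mul_gen w Ss; lia.
rewrite /= inE pw => /orP[/eqP->|sp]; first by rewrite conjgE mulVKg.
have : (len (w * s) < len w)%N.
  by rewrite -pw; apply: cox_length_refl_lt; rewrite ?pw.
by rewrite ltnNge ltnW.
Qed.

(** * Change of the ascent set under multiplication by an ascent *)

Let A := right_ascentsJ S J.

Lemma right_ascentsP w s :
  right_ascents S w s <-> S s /\ (len w < len (w * s))%N.
Proof.
rewrite /right_ascents /=.
split=> -[Ss]; first by move=> ->; rewrite addn1.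
by have := cox_length_mul_gen w Ss => ? ?; split=> //; lia.
Qed.

Variables (w s : W).
Hypothesis As : A w s.

Let Ss : S s. Proof. by case: As => -[]. Qed.
Let len_ws : len (w * s) = (len w).+1.
Proof. by case: As => -[_]; rewrite addn1. Qed.
Let min_ws : min_reps S J (w * s). Proof. by case: As. Qed.

Lemma not_right_ascentsJ_self : ~ A (w * s) s.
Proof.
case=> /right_ascentsP[_]; rewrite -mulgA gen_mulgg // mulg1 len_ws.
by rewrite ltnNge leqnSn.
Qed.

(** The length grows because w is shortest in its coset of the dihedral
    subgroup of s and r. By Deodhar's dichotomy, leaving the minimal
    representatives would mean j * w = w * s * r * s with j in J; comparing
    lengths forces s and r to commute, and then j * w = w * r contradicts
    the minimality of w * r. *)
Lemma right_ascentsJ_persist r : A w r -> r <> s -> A (w * s) r.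
Proof.
move=> [/right_ascentsP[Sr w_wr] min_wr] r_s; have s_r : s <> r by move/esym.
have w_ws : (len w < len (w * s))%N by rewrite len_ws.
have len_wsr := two_ascents_sr Ss Sr s_r w_ws w_wr.
have ws_wsr : (len (w * s) < len (w * s * r))%N by rewrite len_ws len_wsr.
split; first exact/right_ascentsP.
have [//|[j Jj jws]] := min_reps_mul_gen Sr ws_wsr min_ws.
have jw : j * w = w * s * r * s.
  by rewrite -jws -!mulgA gen_mulgg ?mulg1.
have [sr_rs|sr_rs] := pselect (s * r = r * s); last first.
  have := cox_length_gen_mul w (hJ Jj).
  by rewrite jw (two_ascents_srs Ss Sr s_r w_ws w_wr sr_rs) ltnNge leqnSn.
have jw_wr : j * w = w * r.
  by rewrite jw -!mulgA -sr_rs (mulgA s) gen_mulgg // mul1g.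
have := min_wr j Jj; rewrite mulgA jw_wr -mulgA gen_mulgg // mulg1.
by rewrite ltnNge ltnW.
Qed.

(** If r commuted with s, then w * r would be a prefix of the minimal
    representative w * s * r = w * r * s, hence r would be a J-ascent of w.
    And w * (s * r * s) is at most one letter shorter than w * s * r, which is
    two letters longer than w: s * r * s is no inversion of w. *)
Lemma right_ascentsJ_new r : A (w * s) r -> ~ A w r -> DeltaR S J w s r.
Proof.
move=> Awsr nAwr; have [/right_ascentsP[Sr ws_wsr] min_wsr] := Awsr.
split=> //; last first.
  case=> _; have -> : w * (s * r * s) = w * s * r * s by rewrite !mulgA.
  by move=> lt; have := cox_length_mul_gen (w * s * r) Ss; lia.
apply/(cox_length_srs Ss Sr) => sr_rs; apply: nAwr.
have wsr : w * s * r = w * r * s by rewrite -!mulgA sr_rs.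
rewrite wsr in ws_wsr min_wsr.
have := cox_length_mul_gen w Sr; have := cox_length_mul_gen (w * r) Ss => ? ?.
split; first by apply/right_ascentsP; split=> //; lia.
by apply: min_reps_prefix min_wsr => //; lia.
Qed.

(** If r were a descent of w * s, the exchange property would delete a letter
    of w, that is, s * r * s would be an inversion of w. *)
Lemma DeltaR_right_ascentsJ : DeltaR S J w s `<=` A (w * s).
Proof.
move=> r [Sr min_wsr /(cox_length_srs Ss Sr) sr_rs ninv]; split=> //.
apply/right_ascentsP; split=> //; rewrite ltnNge; apply/negP => desc.
have [p [Sp pw redw]] := reduced_word w.
have pws : word_prod (p ++ [:: s]) = w * s.
  by rewrite word_prod_cat pw word_prod_cons word_prod_nil mulg1.
have : r \in refl_seq (p ++ [:: s]).
  apply: exchange => //; last by rewrite pws.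
  by apply: word_in_cat => //; apply: word_in_cons.
rewrite refl_seq_cat mem_cat /= word_prod_cons word_prod_nil mulg1 conjg1 inE.
move=> /orP[/mapP[t tp r_t]|/eqP r_s]; last by case: sr_rs; rewrite r_s.
have srs_t : s * r * s = t by rewrite r_t conjgE mulVKg -mulgA gen_mulgg ?mulg1.
have sV : s^-1 = s by apply: mulg1_eq; rewrite gen_mulgg.
apply: ninv; split; first by exists s, r; rewrite sV.
by rewrite srs_t -pw; apply: cox_length_refl_lt; rewrite ?pw.
Qed.

Lemma DeltaR_sub_Adj : DeltaR S J w s `<=` Adj S s.
Proof.
move=> r [Sr _ /(cox_length_srs Ss Sr) sr_rs _]; split=> //.
  by move/esym.
by move=> r_s; case: sr_rs; rewrite r_s.
Qed.

Lemma right_ascentsJ_mul :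
  A (w * s) = (A w `\ s) `|` (DeltaR S J w s `\` A w).
Proof.
apply/seteqP; split=> [r Awsr|r [[Awr r_s]|[/DeltaR_right_ascentsJ]//]].
  have [Awr|nAwr] := pselect (A w r).
    left; split=> // r_s; apply: not_right_ascentsJ_self.
    by rewrite -{2}r_s.
  by right; split=> //; apply: right_ascentsJ_new.
exact: right_ascentsJ_persist.
Qed.

End MinReps.
End Exchange.

Unset Implicit Arguments.
Set Strict Implicit.
Set Printing Implicit Defensive.

Theorem theorem3p6 (W : groupType) (S J : set W) (w s : W)
  (hWS : coxeter_system S) (hfin : finite_set S) (hJ : J `<=` S)
  (hw : min_reps S J w) (hs : right_ascentsJ S J w s) :
  [/\ right_ascentsJ S J (w * s)%g =
        (right_ascentsJ S J w `\ s) `|`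
        (DeltaR S J w s `\` right_ascentsJ S J w)
      /\ [disjoint right_ascentsJ S J w `\ s
           & DeltaR S J w s `\` right_ascentsJ S J w],
      right_ascentsJ S J w `\` right_ascentsJ S J (w * s)%g = [set s]
    & `| (set_card (right_ascentsJ S J w))%:Z
         - (set_card (right_ascentsJ S J (w * s)%g))%:Z |
        <= Num.max 1 ((cox_deg S s)%:Z - 1)].
Proof.
have A_mul := right_ascentsJ_mul hWS hJ hs.
set A := right_ascentsJ S J w in A_mul *; set D := DeltaR S J w s `\` A.
have disj : [disjoint A `\ s & D] by apply/disj_setPS => r [[Ar _] [_]].
split=> //.
- apply/seteqP; split=> [r [Ar nAr]|r ->].
    by apply: contrapT => r_s; apply: nAr; apply: right_ascentsJ_persist.
  by split=> //; apply: not_right_ascentsJ_self.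
- have finA : finite_set A by apply: sub_finite_set hfin => r [[]].
  have finAdj : finite_set (Adj S s) by apply: sub_finite_set hfin => r [].
  have subD : D `<=` Adj S s by move=> r [/(DeltaR_sub_Adj hWS hs)].
  have finD : finite_set D := sub_finite_set subD finAdj.
  rewrite A_mul -/D /cox_deg /set_card fset_setU //; last exact: finite_setD.
  have leD : (#|` fset_set D| <= #|` fset_set (Adj S s)|)%N.
    by apply: fsubset_leq_card; rewrite -fset_set_sub.
  have cardA : #|` fset_set A| = (#|` fset_set (A `\ s)|).+1.
    by rewrite fset_setD1 // (cardfsD1 s) in_fset_set // mem_set.
  rewrite cardfsU (_ : (_ `&` _)%fset = fset0) ?cardfs0 ?subn0; last first.
    rewrite -fset_setI //; last exact: finite_setD.
    by rewrite (eqP disj) fset_set0.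
  rewrite cardA; lia.
Qed.
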